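(* Let $G=(V,E)$ be a graph and let $\Delta_G$ be its burning configuration space. Then the following holds: (i) the $0$-skeleton $sk_0(\Delta_G)$ coincides with $V$; (ii) the $1$-skeleton $sk_1(\Delta_G)$ coincides with the complement graph $\overline G$.
   Context: A graph $G=(V,E)$ is a non-empty finite set $V$ of vertices together with a set $E$ of unordered pairs of distinct vertices. The complement graph $\overline G$ has the same vertices, two distinct vertices being adjacent in $\overline G$ if and only if they are not adjacent in $G$. The distance $d_G(v,w)$ is the length of a shortest path from $v$ to $w$ ($\infty$ if there is none). Let $S_G=(v_1,\dots,v_k)$, $k\ge 1$, be a non-empty ordered set of vertices of $G$. For $2\le j\le k+1$ let $U_j$ be the induced subgraph of $G$ on the vertices $w$ such that $d_G(v_i,w)\le j-i$ for some $1\le i\le j-1$. The sequence $S_G$ is a burning sequence of $G$ if $v_j\notin U_j$ for $2\le j\le k$ and $U_{k+1}=G$; its underlying set is denoted $\widehat S_G=\{v_1,\dots,v_k\}$. A simplicial complex $\Delta=(V,F)$ is a set $V$ of vertices with a set $F$ of finite non-empty subsets of $V$ (simplexes) containing all singletons and closed under taking non-empty subsets; $\dim\sigma=|\sigma|-1$. The $n$-skeleton $sk_n(\Delta)$ is the subcomplex with vertex set $V$ and all simplexes of dimension at most $n$. A graph is regarded as a simplicial complex of dimension at most one whose $0$-simplexes are its vertices and whose $1$-simplexes are its edges. The burning configuration space $\Delta_G$ is the simplicial complex with vertex set $V$ generated by the sets $\widehat S_G$, where $S_G$ runs over all burning sequences of $G$; that is, its simplexes are exactly the non-empty subsets of the sets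 $\widehat S_G$. *)

(* Defs.v *)
From mathcomp Require Import all_boot.

Set Implicit Arguments.
Unset Strict Implicit.
Unset Printing Implicit Defensive.

(** * Finite simple graphs *)

(* The edge set is encoded by the symmetric irreflexive relation [adj]. *)
Record graph := Graph {
  vertex :> finType;
  adj : rel vertex;
  adj_sym : symmetric adj;
  adj_irr : irreflexive adj;
  vertex_gt0 : 0 < #|vertex|
}.

Section Complement.
Variable G : graph.

Definition compl_adj : rel G := fun v w => (v != w) && ~~ adj v w.

Lemma compl_adj_sym : symmetric compl_adj.
Proof. by move=> v w; rewrite /compl_adj eq_sym adj_sym. Qed.

Lemma compl_adj_irr : irreflexive compl_adj.
Proof. by move=> v; rewrite /compl_adj eqxx. Qed.

Definition complement : graph :=
  Graph compl_adj_sym compl_adj_irr (vertex_gt0 G).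

End Complement.

Section Distance.
Variable G : graph.
Implicit Types (v w : G) (n : nat).

Definition has_path v w n : bool :=
  [exists p : n.-tuple G,
    [&& path (@adj G) v p, uniq (v :: p) & last v p == w]].

(* The least length of a path from [v] to [w], [None] standing for infinity.
   Paths do not repeat vertices, so all lengths are below [#|G|]. *)
Definition dist v w : option nat :=
  ohead [seq n <- iota 0 #|G| | has_path v w n].

Definition dist_le v w n : bool :=
  if dist v w is Some d then d <= n else false.

Lemma dist_leP v w n :
  reflect (exists p : seq G, [/\ path (@adj G) v p, last v p = w & size p <= n])
          (dist_le v w n).
Proof.
rewrite /dist_le /dist; apply: (iffP idP) => [|[p [vp <- pn]]].
  case Ds: [seq _ <- _ | _] => [//|d s] /= dn.
  have: d \in [seq n <- iota 0 #|G| | has_path v w n] by rewrite Ds mem_head.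
  rewrite mem_filter => /andP[/existsP[p /and3P[vp _ /eqP pw]] _].
  by exists p; rewrite size_tuple.
case: (shortenP vp) => q vq uq sub.
have qn : size q <= n.
  apply: leq_trans pn; apply: uniq_leq_size => //.
  by case/andP: uq.
have qG : size q < #|G|.
  by rewrite -[(size q).+1]/(size (v :: q)) -(card_uniqP uq) max_card.
have: size q \in [seq n <- iota 0 #|G| | has_path v (last v q) n].
  rewrite mem_filter mem_iota leq0n add0n qG !andbT.
  apply/existsP; exists (in_tuple q).
  by rewrite vq uq /=.
have: sorted leq [seq n <- iota 0 #|G| | has_path v (last v q) n].
  by apply: (sorted_filter leq_trans); apply: iota_sorted.
case: [seq _ <- _ | _] => [//|d s] /= /(order_path_min leq_trans) /allP ds.
by rewrite inE => /predU1P[<- //|/ds/leq_trans]; apply.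
Qed.

End Distance.

(** * Burning sequences *)

Section Burning.
Variable G : graph.
Implicit Types (s : seq G) (j : nat).

(* The vertex set of the induced subgraph U_j. The index [j] starts from 1 as
   in v_1, ..., v_k, whereas [i : 'I_k] starts from 0: [tnth (in_tuple s) i] is
   v_(i+1). An induced subgraph is determined by its vertex set. *)
Definition burnt s j : {set G} :=
  [set w | [exists i : 'I_(size s),
     (i.+1 <= j.-1) && dist_le (tnth (in_tuple s) i) w (j - i.+1)]].

(* The index [j : 'I_k] starts from 0, so the vertex is v_(j+1). *)
Definition burning_sequence s : bool :=
  [&& s != [::], uniq s,
      [forall j : 'I_(size s),
         (2 <= j.+1) ==> (tnth (in_tuple s) j \notin burnt s j.+1)]
    & burnt s (size s).+1 == [set: G]].

End Burning.

(** * Simplicial complexes on a finite vertex set *)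

(* A complex on the vertex set [V] is given by its set of simplexes. *)
Definition simplicial_complex (V : finType) (D : {set {set V}}) : bool :=
  [&& set0 \notin D,
      [forall v, [set v] \in D]
    & [forall s in D, forall t : {set V},
         (t != set0) && (t \subset s) ==> (t \in D)]].

Definition dim (V : finType) (s : {set V}) : nat := #|s|.-1.

Definition skeleton (V : finType) (n : nat) (D : {set {set V}}) :
  {set {set V}} := [set s in D | dim s <= n].

Definition points (V : finType) : {set {set V}} := [set [set v] | v : V].

Definition graph_complex (G : graph) : {set {set G}} :=
  points G :|: [set [set e.1; e.2] | e : G * G & adj e.1 e.2].

(* Burning sequences do not repeat vertices, so their length is at most [#|G|]
   (see [burning_complexP]). That every singleton is a simplex is not built
   into the definition. *)
Definition burning_complex (G : graph) : {set {set G}} :=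
  [set t : {set G} | (t != set0) &&
     [exists k : 'I_#|G|.+1, [exists s : k.-tuple G,
        burning_sequence s && (t \subset [set v in s])]]].

Lemma burning_complexP (G : graph) (t : {set G}) :
  reflect (t != set0 /\
           exists2 s : seq G, burning_sequence s & t \subset [set v in s])
          (t \in burning_complex G).
Proof.
rewrite inE; apply: (iffP andP) => -[t0 H]; split=> //.
  by case/existsP: H => k /existsP[s /andP[bs ts]]; exists s.
case: H => s bs ts; have us: uniq s by case/and4P: bs.
have sG: size s < #|G|.+1 by rewrite ltnS -(card_uniqP us) max_card.
by apply/existsP; exists (Ordinal sG); apply/existsP; exists (in_tuple s);
  rewrite bs.
Qed.

(* Main.v *)
Require Import Defs.
From mathcomp Require Import all_boot.

(** The vertices of a burning sequence satisfy d(v_i, v_j) > j - i >= 1 for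
    i < j, so they are pairwise distinct and non-adjacent: a two-element
    simplex is an edge of the complement graph.

    Conversely this separation condition is the only obstruction to occurring
    at the start of a burning sequence.  It already makes a sequence
    duplicate-free, and a vertex outside U_(k+1) can be appended without
    changing U_j for j <= k+1; as V is finite, appending such vertices greedily
    ends with U_(k+1) = G ([separated_extends]).  The sequence (v) is separated
    for every v, and (v, w) is separated as soon as v and w are distinct and
    non-adjacent, which gives all the vertices and all the edges of the
    complement graph. *)

Set Implicit Arguments.
Unset Strict Implicit.
Unset Printing Implicit Defensive.

Section BurningSequences.
Variable G : graph.
Implicit Types (v w x : G) (s : seq G).

(** * Distances zero and one *)

Lemma dist_le_refl v n : dist_le v v n.
Proof. by apply/dist_leP; exists [::]. Qed.

Lemma dist_le1 v w : dist_le v w 1 = (v == w) || adj v w.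
Proof.
apply/dist_leP/orP => [[[|x [|y p]] [] //= + <-]|[/eqP->|vw]].
- by left.
- by rewrite andbT; right.
- by exists [::].
- by exists [:: w]; rewrite /= vw.
Qed.

Lemma dist_le_leq v w m n : m <= n -> dist_le v w m -> dist_le v w n.
Proof.
move=> mn /dist_leP[p [vp pw pm]].
by apply/dist_leP; exists p; split=> //; apply: leq_trans mn.
Qed.

(** * Separated sequences *)

(** Indexing by [nth] and counting from 0 throughout removes the dependence of
    the index type on the sequence, and turns the radius into [j - i]. *)
Lemma burntP x0 s w j :
  reflect (exists i, [/\ i < size s, i < j & dist_le (nth x0 s i) w (j - i)])
          (w \in burnt s j.+1).
Proof.
rewrite inE; apply: (iffP existsP) => [[i]|[i [si ij d]]].
  by rewrite (tnth_nth x0) subSS => /andP[ij d]; exists i; rewrite ltn_ord.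
by exists (Ordinal si); rewrite (tnth_nth x0) subSS /= ij.
Qed.

(** The conditions v_j \notin U_j, unfolded into a condition on pairs of terms
    so that it does not refer to the sets U_j of a sequence that grows.  The
    default [x0] is never returned; quantifying over it includes the empty
    sequence. *)
Definition separated s : Prop :=
  forall x0 i j, i < j -> j < size s ->
  ~~ dist_le (nth x0 s i) (nth x0 s j) (j - i).

Lemma separated_uniq s : separated s -> uniq s.
Proof.
case: s => [//|x0 s] sep; apply/(uniqP x0) => i j si sj eq_ij.
case: (ltngtP i j) => // ij.
- by have := sep x0 _ _ ij sj; rewrite eq_ij dist_le_refl.
- by have := sep x0 _ _ ij si; rewrite eq_ij dist_le_refl.
Qed.

Lemma burning_sequenceP s :
  reflect [/\ s != [::], separated s & burnt s (size s).+1 = [set: G]]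
          (burning_sequence s).
Proof.
apply: (iffP and4P) => [[s0 us /forallP lit /eqP cov]|[s0 sep cov]].
  split=> // x0 i j ij sj.
  have := lit (Ordinal sj); rewrite (tnth_nth x0) /= ltnS.
  rewrite (leq_ltn_trans (leq0n i) ij) /=.
  apply: contra => d; apply/(burntP x0).
  by exists i; split=> //; apply: ltn_trans sj.
split; rewrite ?separated_uniq ?cov //.
apply/forallP => -[j sj]; apply/implyP => _ /=.
have x0 : G by case: (s) sj => [//|x].
rewrite (tnth_nth x0) /=; apply/(burntP x0) => -[i [_ ij]].
exact/negP/sep.
Qed.

Lemma separated_rcons s x :
  separated s -> x \notin burnt s (size s).+1 -> separated (rcons s x).
Proof.
move=> sep xU x0 i j ij; rewrite size_rcons ltnS leq_eqVlt.
case/predU1P=> [ej|sj].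
  rewrite ej in ij *; rewrite nth_rcons ij nth_rcons ltnn eqxx.
  by apply: contra xU => d; apply/(burntP x0); exists i.
by rewrite !nth_rcons sj (ltn_trans ij sj); apply: sep.
Qed.

(** Greedy extension terminates because separated sequences have no repeated
    vertices, hence have length at most the order of the graph. *)
Lemma separated_extends s :
  s != [::] -> separated s ->
  exists2 s', burning_sequence s' & {subset s <= s'}.
Proof.
have [n] := ubnP (#|G| - size s); elim: n s => // n IHn s sn s0 sep.
have [cov|] := eqVneq (burnt s (size s).+1) [set: G].
  by exists s => //; apply/burning_sequenceP.
rewrite -subTset => /subsetPn[x _ xU].
have sep' := separated_rcons sep xU.
have sG : size s < #|G|.
  rewrite -(size_rcons s x) -(card_uniqP (separated_uniq sep')).
  exact: max_card.
have [||//|s' bs' ss'] := IHn (rcons s x).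
- by rewrite size_rcons -ltnS (leq_trans _ sn) // ltnS ltn_sub2l.
- by rewrite -size_eq0 size_rcons.
by exists s' => // v sv; apply: ss'; rewrite mem_rcons inE sv orbT.
Qed.

Lemma separated1 v : separated [:: v].
Proof. by move=> x0 i [|j]. Qed.

Lemma separated2 v w : compl_adj v w -> separated [:: v; w].
Proof.
move=> vw x0 [|i] [|[|j]] // _ _.
by rewrite /= subn0 dist_le1 negb_or.
Qed.

(** Two terms of index i < j are at distance more than j - i, and j - i >= 1. *)
Lemma burning_sequence_independent s v w :
  burning_sequence s -> v \in s -> w \in s -> ~~ adj v w.
Proof.
case/burning_sequenceP=> _ sep _ /(nthP v)[i si <-] /(nthP v)[j sj <-].
wlog ij : i j si sj / i < j => [th|].
  case: (ltngtP i j) => [ij|ji|->]; first exact: th.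
    by rewrite adj_sym; apply: th.
  by rewrite adj_irr.
apply: contra (sep v i j ij sj) => a.
apply: (@dist_le_leq _ _ 1); first by rewrite subn_gt0.
by rewrite dist_le1 a orbT.
Qed.

(** * Simplexes of the burning complex *)

Lemma separated_simplex s :
  s != [::] -> separated s -> [set v in s] \in burning_complex G.
Proof.
move=> s0 sep; apply/burning_complexP; split.
  case: s s0 {sep} => // v s _.
  by apply/set0Pn; exists v; rewrite inE mem_head.
have [s' bs' ss'] := separated_extends s0 sep.
by exists s' => //; apply/subsetP => v; rewrite !inE => /ss'.
Qed.

Lemma set1_simplex v : [set v] \in burning_complex G.
Proof.
have := separated_simplex (isT : [:: v] != [::]) (@separated1 v).
by rewrite set_cons set_nil setU0.
Qed.

Lemma set2_simplex v w :
  v != w -> ([set v; w] \in burning_complex G) = ~~ adj v w.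
Proof.
move=> vw; apply/idP/idP => [/burning_complexP[_ [s bs /subsetP vws]]|a].
  by apply: (burning_sequence_independent bs);
    [have := vws v | have := vws w]; rewrite !inE eqxx ?orbT; apply.
have c : compl_adj v w by rewrite /compl_adj vw.
have := separated_simplex (isT : [:: v; w] != [::]) (separated2 c).
by rewrite !set_cons set_nil setU0.
Qed.

Lemma burning_complex_simplicial : simplicial_complex (burning_complex G).
Proof.
apply/and3P; split; first by rewrite inE eqxx.
  by apply/forallP => v; apply: set1_simplex.
apply/forall_inP => t /burning_complexP[_ [s bs ts]].
apply/forallP => u; apply/implyP => /andP[u0 ut].
by apply/burning_complexP; split=> //; exists s => //; apply: subset_trans ts.
Qed.

Lemma skeleton0_burning_complex : skeleton 0 (burning_complex G) = points G.
Proof.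
apply/setP => t; rewrite inE; apply/andP/imsetP => [[tB dt]|[v _ ->]].
  have /burning_complexP[t0 _] := tB.
  have /cards1P[v ->] : #|t| == 1.
    by rewrite eqn_leq card_gt0 t0 andbT -subn_eq0 subn1 -leqn0.
  by exists v.
by rewrite set1_simplex /dim cards1.
Qed.

Lemma skeleton1_burning_complex :
  skeleton 1 (burning_complex G) = graph_complex (complement G).
Proof.
apply/setP => t; rewrite in_setU; apply/idP/orP.
  rewrite inE => /andP[tB dt].
  have [t2|t1] := ltnP 1 #|t|; last first.
    left; rewrite -[points _]skeleton0_burning_complex inE tB /dim.
    by rewrite -subn1 leqn0 subn_eq0.
  right; have /cards2P[v [w [vw et]]] : #|t| == 2.
    by rewrite eqn_leq t2 andbT; move: dt t2; rewrite /dim; case: #|t|.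
  apply/imsetP; exists (v, w) => //.
  by rewrite inE /= /compl_adj vw -set2_simplex // -et.
case=> /imsetP[]; first by move=> v _ ->; rewrite inE set1_simplex /dim cards1.
case=> v w; rewrite inE => /andP[/= vw a] ->.
by rewrite inE set2_simplex // a /dim cards2 vw.
Qed.

End BurningSequences.

Theorem proposition4p11 (G : graph) :
  [/\ simplicial_complex (burning_complex G),
      skeleton 0 (burning_complex G) = points G
    & skeleton 1 (burning_complex G) = graph_complex (complement G)].
Proof.
split; first exact: burning_complex_simplicial.
  exact: skeleton0_burning_complex.
exact: skeleton1_burning_complex.
Qed.
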